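(* Let $f$ be a bounded analytic function in the unit disc $D=\{|z|<1\}$, written as $f(z)=\sum_{j=0}^\infty(-a_j)z^j$, and let $n_0=n_0(f)$. Then there exists an integer $n_1=n_1(f)\ge n_0$ such that for every $n\ge n_1$, with $N=2n+1$: (1) all $N$ roots $z_1,\dots,z_N$ of the polynomial $P_n(f;z)$ are simple and lie on the unit circle $|z|=1$; (2) the points $\lambda_k:=z_k^{-1}$, $k=1,\dots,N$, are pairwise distinct, satisfy $|\lambda_k|=1$, and \[S_{j+1}(\lambda)-a_j=0,\qquad j=0,\dots,n-1,\] \[|S_{j+1}(\lambda)-a_j|<\frac{r^{n+1}(r-\varepsilon)^{-j}}{2\varepsilon(1-r)},\qquad j\ge n,\] for any numbers $r,\varepsilon$ with $0<\varepsilon<r<1$. Moreover, for the equalities $S_{j+1}(\lambda)-a_j=0$, $j=0,\dots,n-1$, to hold (with $\lambda_k$ the reciprocals of the roots of $P_n(f;z)$) it suffices that $n\ge n_0$.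
   Context: For $f$ analytic in $D$, $s_n(z)=s_n(f;z)$ denotes the $n$-th Taylor polynomial (degree $\le n$) of $\exp\left(\int_0^z f(\zeta)\,d\zeta\right)$; note $s_n(0)=1$. With $N:=2n+1$, set $P_n(z)=P_n(f;z):=s_n(z)+z^N\overline{s}_n(1/z)$, where $\overline{s}_n$ is the polynomial whose coefficients are the complex conjugates of those of $s_n$; $\deg P_n=N$. $n_0(f)$ is the smallest natural number $n$ such that $s_n(f;z)$ has no roots in the closed disc $|z|\le 1$. For points $\lambda_1,\dots,\lambda_N$ on the unit circle, $S_\nu(\lambda)=\lambda_1^\nu+\dots+\lambda_N^\nu$, $\nu\in\mathbb{N}$. *)

(* Defs.v *)
From HB Require Import structures.
From mathcomp Require Import all_boot all_order all_algebra.
From mathcomp Require Import complex.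
From mathcomp Require Import all_classical all_reals all_analysis.
Set Implicit Arguments. Unset Strict Implicit. Unset Printing Implicit Defensive.
Import Order.TTheory GRing.Theory Num.Theory.
Import numFieldNormedType.Exports.
Local Open Scope classical_set_scope.
Local Open Scope ring_scope.

(* Topology / normed structure on R[i] (the norm is the usual modulus), so
   that convergence of series in C can be expressed. *)
HB.instance Definition _ (R : rcfType) := NormedModule.copy R[i] (R[i])^o.

Section Defs.
Variable R : realType.
Local Notation C := R[i].

(* f(z) = \sum_j (-a_j) z^j.  The primitive  F(z) = \int_0^z f = \sum_j (-a_j) z^(j+1)/(j+1),
   truncated at degree n (its coefficient of z^i, i <= n). *)
Definition prim_trunc (a : nat -> C) (n : nat) : {poly C} :=
  \poly_(i < n.+1) (if i is k.+1 then - a k / k.+1%:R else 0).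

(* s_n(f;z): the n-th Taylor polynomial (degree <= n) of exp(F(z)).
   Since F(0) = 0, the Taylor coefficients of exp(F) = \sum_k F^k/k! up to
   degree n only involve the coefficients of F up to degree n and the
   powers F^k with k <= n. *)
Definition s_poly (a : nat -> C) (n : nat) : {poly C} :=
  \poly_(i < n.+1) (\sum_(k < n.+1) (prim_trunc a n ^+ k)`_i / (k`!)%:R).

(* P_n(f;z) = s_n(z) + z^N * conj(s_n)(1/z), N = 2n+1.
   The coefficient of z^i in z^N \bar s_n(1/z) is conj(coef of z^(N-i) in s_n). *)
Definition P_poly (a : nat -> C) (n : nat) : {poly C} :=
  s_poly a n + \poly_(i < (2 * n + 1).+1) conjc ((s_poly a n)`_(2 * n + 1 - i)).

Definition no_roots_closed_disc (p : {poly C}) : Prop :=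
  forall z : C, `|z| <= 1 -> ~~ root p z.

Definition is_n0 (a : nat -> C) (n0 : nat) : Prop :=
  (0 < n0)%N /\ no_roots_closed_disc (s_poly a n0) /\
  (forall m : nat, (0 < m)%N -> (m < n0)%N -> ~ no_roots_closed_disc (s_poly a m)).

Definition psum (l : seq C) (nu : nat) : C := \sum_(x <- l) x ^+ nu.

End Defs.

(* Main.v *)
Require Import Defs.
From HB Require Import structures.
From mathcomp Require Import all_boot all_order all_algebra.
From mathcomp Require Import cyclic separable cyclotomic.
From mathcomp Require Import complex.
From mathcomp Require Import all_classical all_reals all_analysis.
From mathcomp Require Import ring lra zify.
Import Order.TTheory GRing.Theory Num.Theory.
Import numFieldNormedType.Exports.
Local Open Scope classical_set_scope.
Local Open Scope ring_scope.
Set Implicit Arguments. Unset Strict Implicit. Unset Printing Implicit Defensive.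

(** Let c_k be the Taylor coefficients of G = exp(int f).  Since P_n agrees with
    s_n up to degree n, P_n'/P_n = - sum_j S_{j+1} z^j agrees with G'/G = f up to
    degree n - 1, which gives S_{j+1} = a_j for j < n; the next coefficient is
    S_{n+1} - a_n = (n+1) (c_{n+1} - conj c_n).

    If s_n has no root in the closed disc, a Blaschke-type estimate gives
    |s_n(z)| > |z^N conj(s_n)(1/z)| for 0 < |z| < 1, so by symmetry the roots of P_n
    are on the circle.

    Boundedness of f gives sum |a_k|^2 < oo (Parseval, discretized at roots of unity),
    hence sum |a_k|/(k+1) < oo, so G and 1/G have absolutely summable coefficients.
    Multiplying the truncations of G and 1/G gives 1 up to a vanishing tail, so s_n
    has no root in the closed disc for n large; moreover c_n -> 0.

    The remainder estimate is then elementary: its right-hand side exceeds n + 1 when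
    j = n and is at least 4 (j + 1) when j > n, whatever r and epsilon are, while
    |S_{j+1}| <= N and a is bounded. *)

(** * Taylor coefficients and power sums *)

Lemma dvdXnP (F : fieldType) n (p : {poly F}) :
  reflect (forall i, (i < n)%N -> p`_i = 0) ('X^n %| p).
Proof.
apply: (iffP idP) => [/dvdpP[q ->] i lt_in|p0]; first by rewrite coefMXn lt_in.
rewrite -(poly_take_drop n p) (_ : take_poly n p = 0) ?add0r ?dvdp_mull //.
by apply/polyP => i; rewrite coef_take_poly coef0; case: ifP => // /p0.
Qed.

(* Q' / Q = - sum_i S_{i+1} X^i, truncated at order T. *)
Lemma newton_power_sums (F : fieldType) (lam : seq F) T :
  let Q := \prod_(l <- lam) (1 - l *: 'X) in
  'X^T %| Q^`() + Q * \poly_(i < T) (\sum_(l <- lam) l ^+ i.+1).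
Proof.
rewrite /=; elim: lam => [|l lam IH].
  rewrite !big_nil derivC add0r mul1r.
  by apply/dvdXnP => i _; rewrite coef_poly big_nil if_same.
rewrite big_cons; set Q := \prod_(_ <- lam) _ in IH *.
set S := \poly_(i < T) _ in IH.
(* Cutting the geometric series at order [T] leaves a remainder that is a multiple of ['X^T],
   invisible in the claim. *)
have geom : (1 - l *: 'X) * (\poly_(i < T) l ^+ i.+1) = l%:P - l ^+ T.+1 *: 'X^T.
  apply/polyP => i; rewrite mulrBl mul1r -scalerAl mulrC coefB coefZ coefMX.
  rewrite !coefE.
  case: i => [|i] /=.
    by rewrite mulr0 subr0; case: T {IH S} => [|T] //=; rewrite ?expr1 ?mulr1 ?mulr0 ?subrr ?subr0.
  case: (ltngtP i.+1 T) => [_|_|<-].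
  - by rewrite -exprS subrr mulr0 subr0.
  - by rewrite !mulr0.
  - by rewrite -exprS mulr1.
rewrite (_ : \poly_(i < T) _ = \poly_(i < T) l ^+ i.+1 + S); last first.
  by apply/polyP => i; rewrite coefD !coef_poly big_cons; case: ifP; rewrite ?addr0.
rewrite mulrDr -(mulrC Q) -[X in _ + (X + _)]mulrA geom derivM.
rewrite (_ : (1 - l *: 'X)^`() = - l%:P); last first.
  by rewrite derivB derivZ derivX -polyC1 derivC sub0r alg_polyC.
rewrite [X in _ %| X](_ : _ = (1 - l *: 'X) * (Q^`() + Q * S) - Q * (l ^+ T.+1)%:P * 'X^T).
  by rewrite dvdp_sub // dvdp_mull.
rewrite -!mul_polyC; ring.
Qed.

(** Since X - z = -z (1 - z^-1 X), the roots enter through their reciprocals; the nonzero constant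
    coefficient excludes the root 0. *)
Lemma newton_power_sums_roots (F : fieldType) (zs : seq F) (c : F) (P : {poly F}) T :
  P = c *: \prod_(z <- zs) ('X - z%:P) -> P`_0 != 0 ->
  'X^T %| P^`() + P * \poly_(i < T) (\sum_(l <- [seq z^-1 | z <- zs]) l ^+ i.+1).
Proof.
move=> defP P0; pose d := c * \prod_(z <- zs) (- z).
have zs0 z : z \in zs -> z != 0.
  move=> z_zs; apply: contra P0 => /eqP z0; rewrite -horner_coef0 defP hornerZ.
  by rewrite -root_prod_XsubC z0 in z_zs; rewrite (rootP z_zs) mulr0.
have {}defP : P = d *: \prod_(l <- [seq z^-1 | z <- zs]) (1 - l *: 'X).
  rewrite defP /d -scalerA; congr (_ *: _); rewrite big_map -[RHS]mul_polyC rmorph_prod.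
  rewrite -big_split /= !big_seq; apply: eq_bigr => z /zs0 z0.
  by rewrite mul_polyC scalerBr scalerA mulNr divff // scaleN1r opprK alg_polyC polyCN addrC.
rewrite defP derivZ -scalerAl -scalerDr -mul_polyC dvdp_mull //.
exact: newton_power_sums.
Qed.

Section ExpCoefficients.
Variables (R : realType) (a : nat -> R[i]).

(** This is G' = F' G modulo X^n. The sum [E] satisfies E' = F' (E - F^n/n!), and X^n divides F^n
    because F(0) = 0. Cutting [E] above degree n is an error of order n + 1, which differentiation
    lowers to n. *)
Lemma s_poly_deriv n :
  'X^n %| (s_poly a n)^`() - (prim_trunc a n)^`() * s_poly a n.
Proof.
set F := prim_trunc a n.
pose E := \sum_(k < n.+1) (k`!%:R)^-1 *: F ^+ k.
have sE : s_poly a n = take_poly n.+1 E.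
  apply/polyP => i; rewrite coef_poly coef_take_poly; case: ifP => // _.
  by rewrite coef_sum; apply: eq_bigr => k _; rewrite coefZ mulrC.
have XF : 'X^n %| F ^+ n.
    apply: dvdp_exp2r; rewrite -[X in X %| _]expr1; apply/dvdXnP => -[|i] //= _.
    by rewrite coef_poly.
have E' : E^`() = F^`() * (E - (n`!%:R)^-1 *: F ^+ n).
    rewrite [in RHS]/E (big_ord_recr n) /= addrK /E raddf_sum /= big_ord_recl /= derivZ expr0 derivC.
    rewrite scaler0 add0r mulr_sumr; apply: eq_bigr => k _.
    rewrite (_ : bump 0 k = k.+1) // derivZ deriv_exp /= -[_ *+ k.+1]scaler_nat scalerA -scalerAr; congr (_ *: _).
    by rewrite factS natrM invfM mulrC mulVKf ?pnatr_eq0.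
have XsE : 'X^(n.+1) %| s_poly a n - E.
    by apply/dvdXnP => i lt_in; rewrite sE coefB coef_take_poly lt_in subrr.
have Xs'E' : 'X^n %| (s_poly a n)^`() - E^`().
    apply/dvdXnP => i lt_in; rewrite -derivB coef_deriv.
    by have /dvdXnP -> := XsE; rewrite ?mul0rn.
  rewrite [X in _ %| X](_ : _ = ((s_poly a n)^`() - E^`()) - F^`() * (s_poly a n - E)
             - (n`!%:R)^-1%:P * F^`() * F ^+ n); last first.
    by rewrite E' -!mul_polyC; ring.
  apply: dvdp_sub; last exact: dvdp_mull.
  by apply: dvdp_sub => //; apply: dvdp_mull; apply: dvdp_trans XsE; rewrite dvdp_exp2l.
Qed.

Lemma coef_prim_trunc_deriv n i : (i < n)%N -> (prim_trunc a n)^`()`_i = - a i.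
Proof.
by move=> lt_in; rewrite coef_deriv coef_poly ltnS lt_in /= -[LHS]mulr_natr divfK ?pnatr_eq0.
Qed.

Lemma size_s_poly n : (size (s_poly a n) <= n.+1)%N.
Proof. exact: size_poly. Qed.

Lemma s_poly_coef0 n : (s_poly a n)`_0 = 1.
Proof.
rewrite coef_poly /= big_ord_recl /= expr0 coef1 fact0 divr1 big1 ?addr0 // => k _.
by rewrite /bump /= exprS coef0M coef_poly /= mul0r mul0r.
Qed.

Lemma s_poly_coefS n k : (k < n)%N ->
  (s_poly a n)`_k.+1 *+ k.+1 = \sum_(i < k.+1) (s_poly a n)`_(k - i) * - a i.
Proof.
move=> lt_kn; have /dvdXnP/(_ _ lt_kn)/eqP := s_poly_deriv n.
rewrite coefB coef_deriv subr_eq0 => /eqP ->; rewrite mulrC coefMr.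
by apply: eq_bigr => i _; rewrite coef_prim_trunc_deriv // (leq_trans _ lt_kn).
Qed.

(** The recurrence [s_poly_coefS] has the same form for every n, so it determines the Taylor
    coefficients c_k of G whatever the truncation. *)
Lemma s_poly_coef_stable n m k : (k <= n)%N -> (k <= m)%N ->
  (s_poly a n)`_k = (s_poly a m)`_k.
Proof.
elim/ltn_ind: k => -[|k] IH lt_kn lt_km; first by rewrite !s_poly_coef0.
have k0 : k.+1%:R != 0 :> R[i] by rewrite pnatr_eq0.
apply: (mulIf k0); rewrite !mulr_natr !s_poly_coefS //.
apply: eq_bigr => i _; rewrite IH // ?ltnS ?leq_subr //.
  exact: leq_trans (leq_subr _ _) (ltnW lt_kn).
exact: leq_trans (leq_subr _ _) (ltnW lt_km).
Qed.

Lemma coef_P_poly n k : (k <= 2 * n + 1)%N ->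
  (P_poly a n)`_k = (s_poly a n)`_k + conjc (s_poly a n)`_(2 * n + 1 - k).
Proof. by move=> le_kn; rewrite coefD [X in _ + X]coef_poly ltnS le_kn. Qed.

Lemma coef_P_poly_low n k : (k <= n)%N -> (P_poly a n)`_k = (s_poly a n)`_k.
Proof.
move=> le_kn; rewrite coef_P_poly; last by lia.
rewrite [X in conjc X]nth_default ?conjc0 ?addr0 //.
by apply: leq_trans (size_s_poly n) _; lia.
Qed.

Lemma P_poly_coef0 n : (P_poly a n)`_0 = 1.
Proof. by rewrite coef_P_poly_low // s_poly_coef0. Qed.

Lemma size_P_poly n : size (P_poly a n) = (2 * n + 2)%N.
Proof.
have leS : (size (P_poly a n) <= 2 * n + 2)%N.
  rewrite addnS; apply: leq_trans (size_polyD _ _) _.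
  by rewrite geq_max size_poly (leq_trans (size_s_poly n)) //; lia.
apply/eqP; rewrite eqn_leq leS /= addnS; apply: contraT; rewrite -leqNgt.
move=> /(nth_default 0) /eqP; rewrite coef_P_poly // subnn s_poly_coef0 conjc1.
rewrite [X in X + _]nth_default ?add0r ?oner_eq0 //.
by apply: leq_trans (size_s_poly n) _; lia.
Qed.

Section PowerSums.
Variables (n : nat) (zs : seq R[i]) (c : R[i]).
Hypothesis defP : P_poly a n = c *: \prod_(z <- zs) ('X - z%:P).
Let lam := [seq z^-1 | z <- zs].

(** Modulo X^n, P S = -P' = -s' = -F' s = -F' P. As P(0) = 1, P is coprime to X^n and cancels,
    leaving S = -F', whose coefficients are the a_j. *)
Lemma psum_P_poly j : (j < n)%N -> psum lam j.+1 = a j.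
Proof.
move=> lt_jn; set P := P_poly a n.
have P0 : P`_0 != 0 by rewrite P_poly_coef0 oner_eq0.
have XPS := newton_power_sums_roots n defP P0; rewrite -/lam in XPS.
set S := \poly_(i < n) _ in XPS. rewrite -/P in XPS.
have XPs : 'X^(n.+1) %| P - s_poly a n.
  by apply/dvdXnP => i lt_in; rewrite coefB coef_P_poly_low ?subrr.
have XPs' : 'X^n %| P^`() - (s_poly a n)^`().
  apply/dvdXnP => i lt_in; rewrite -derivB coef_deriv.
  by have /dvdXnP -> := XPs; rewrite ?mul0rn.
have {}XPs : 'X^n %| P - s_poly a n by rewrite (dvdp_trans _ XPs) // dvdp_exp2l.
have : 'X^n %| P * ((prim_trunc a n)^`() + S).
  rewrite [X in _ %| X](_ : _ = (P^`() + P * S) - (P^`() - (s_poly a n)^`())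
    - ((s_poly a n)^`() - (prim_trunc a n)^`() * s_poly a n)
    + (prim_trunc a n)^`() * (P - s_poly a n)); last by ring.
  apply: dvdp_add; last exact: dvdp_mull.
  by apply: dvdp_sub; [apply: dvdp_sub | exact: s_poly_deriv].
rewrite Gauss_dvdpr; last first.
  by rewrite coprimep_expl // coprimep_sym coprimepX /root horner_coef0.
move=> /dvdXnP/(_ _ lt_jn)/eqP.
rewrite coefD coef_prim_trunc_deriv // coef_poly lt_jn addrC subr_eq0 => /eqP <-.
by [].
Qed.

(** The coefficient of X^n in P' + P S involves the first term of the reversed part, conj c_n in
    degree n + 1. On subtracting the recurrence for c_{n+1}, the terms with i < n cancel because
    S_{i+1} = a_i there. *)
Lemma psum_P_poly_next :
  psum lam n.+1 - a n = ((s_poly a n.+1)`_n.+1 - conjc (s_poly a n)`_n) *+ n.+1.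
Proof.
set P := P_poly a n; have P0 : P`_0 != 0 by rewrite P_poly_coef0 oner_eq0.
have /dvdXnP/(_ n (ltnSn n)) := newton_power_sums_roots n.+1 defP P0.
rewrite -/lam coefD coef_deriv coefMr (coef_P_poly (k := n.+1)); last by lia.
rewrite [X in X + conjc _]nth_default ?size_s_poly // add0r.
rewrite (_ : 2 * n + 1 - n.+1 = n)%N; last by lia.
rewrite big_ord_recr /= (subnn n) [X in _ + (_ + _ * X)]coef_poly ltnSn P_poly_coef0 mul1r mulrnBl.
rewrite s_poly_coefS //. rewrite big_ord_recr /= (subnn n) s_poly_coef0 mul1r.
rewrite (eq_bigr (fun i : 'I_n => (s_poly a n.+1)`_(n - i) * a i)); last first.
  move=> i _; rewrite coef_poly ltnS (ltnW (ltn_ord i)) coef_P_poly_low ?leq_subr //.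
  rewrite (s_poly_coef_stable (m := n.+1)) ?leq_subr // ?(leq_trans (leq_subr _ _)) //.
  by congr (_ * _); apply: psum_P_poly.
have -> : \sum_(i < n) (s_poly a n.+1)`_(n - i) * - a i
    = - \sum_(i < n) (s_poly a n.+1)`_(n - i) * a i.
  by rewrite -sumrN; apply: eq_bigr => i _; rewrite mulrN.
set x := \sum_(i < n) _; set y := \sum_(l <- lam) _; move=> xy.
rewrite /psum -/y; move: xy; set w := conjc _ *+ _; move=> xy.
by rewrite -[LHS]subr0 -[in LHS]xy; ring.
Qed.

End PowerSums.
End ExpCoefficients.

(** * Self-inversive polynomials *)

Section SelfInversive.
Variable C : numClosedFieldType.
Implicit Types (s : {poly C}) (w z : C) (ws : seq C).

(* z^N \bar s(1/z) *)
Definition conj_rev N s : {poly C} := \poly_(i < N.+1) (s`_(N - i))^*.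

Lemma horner_conj_rev N s z : (size s <= N.+1)%N -> z != 0 ->
  (conj_rev N s).[z] = z ^+ N * (s.[(z^*)^-1])^*.
Proof.
move=> le_sN z0; rewrite horner_poly (horner_coef_wide _ le_sN) rmorph_sum mulr_sumr.
rewrite [RHS](reindex_inj rev_ord_inj); apply: eq_bigr => -[i lt_iN] _ /=.
rewrite subSS. rewrite rmorphM rmorphXn /= fmorphV /= conjCK exprVn mulrCA; congr (_ * _).
by rewrite -expfB_cond ?(negPf z0) ?add0n ?leq_subr // subKn // -ltnS.
Qed.

(** The operator X d/dX multiplies the coefficient of X^i by i, and reversal exchanges i with N -
    i. *)
Lemma deriv_conj_rev N s :
  'X * (conj_rev N s)^`() = (conj_rev N s) *+ N - conj_rev N ('X * s^`()).
Proof.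
have coefXd (p : {poly C}) k : ('X * p^`())`_k = p`_k *+ k.
  by rewrite coefXM coef_deriv; case: k.
apply/polyP => i; rewrite coefXd coefB coefMn !coef_poly.
case: ifP => [lt_iN|_]; last by rewrite !mul0rn subr0.
by rewrite coefXd rmorphMn /= -mulrnBr ?leq_subr // subKn // -ltnS.
Qed.

(** The difference of the squared moduli is (1 - |z|^2) (|w|^2 - 1). *)
Lemma norm_reflect_le w z : 1 < `|w| -> `|z| < 1 -> `|1 - w^* * z| <= `|z - w|.
Proof.
move=> w1 z1; rewrite -ler_sqr ?nnegrE ?normr_ge0 // -subr_ge0 !normCK.
rewrite !rmorphB !rmorphM /= conjCK conjC1.
rewrite (_ : _ - _ = (1 - z * z^*) * (w * w^* - 1)); last by ring.
by rewrite -!normCK mulr_ge0 // subr_ge0 ?exprn_ile1 ?exprn_ege1 // ltW.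
Qed.

(** Each root w contributes one reflection estimate, since |z| |1/conj z - w| = |1 - conj(w) z|. *)
Lemma norm_prod_reflect_le ws z : (forall w, w \in ws -> 1 < `|w|) -> z != 0 -> `|z| < 1 ->
  let q := \prod_(w <- ws) ('X - w%:P) in
  `|z| ^+ size ws * `|q.[(z^*)^-1]| <= `|q.[z]|.
Proof.
move=> ws1 z0 z1 /=; elim: ws ws1 => [|w ws IH] ws1.
  by rewrite !big_nil !hornerC mul1r.
rewrite !big_cons !hornerM /= !hornerXsubC exprS !normrM mulrACA.
apply: ler_pM; rewrite ?mulr_ge0 ?exprn_ge0 ?normr_ge0 //; last first.
  by apply: IH => v v_ws; rewrite ws1 // inE v_ws orbT.
rewrite -[X in _ * X <= _]norm_conjC -normrM; apply: le_trans (norm_reflect_le (ws1 w _) z1).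
  by rewrite rmorphB /= fmorphV /= conjCK mulrBr mulfV // mulrC.
by rewrite inE eqxx.
Qed.

(** Here z q'/q is the sum of the z/(z - w), and 1 - 2 Re(z/(z - w)) = (|w|^2 - |z|^2)/|z - w|^2 is
    nonnegative. *)
Lemma logderiv_disc_le ws z : (forall w, w \in ws -> 1 < `|w|) -> `|z| = 1 ->
  let q := \prod_(w <- ws) ('X - w%:P) in
  z * q^`().[z] / q.[z] + (z * q^`().[z] / q.[z])^* <= (size ws)%:R.
Proof.
move=> ws1 z1 /=; elim: ws ws1 => [|w ws IH] ws1.
  by rewrite !big_nil -polyC1 derivC horner0 mulr0 mul0r conjC0 addr0.
have w1 : 1 < `|w| by rewrite ws1 ?inE ?eqxx.
have ws1' v : v \in ws -> 1 < `|v| by move=> v_ws; rewrite ws1 // inE v_ws orbT.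
have zv v : 1 < `|v| -> z - v != 0.
  by move=> v1; rewrite subr_eq0; apply: contraTneq v1 => <-; rewrite z1 ltxx.
have q0 : (\prod_(w <- ws) ('X - w%:P)).[z] != 0.
  rewrite -rootE root_prod_XsubC; apply/negP => /ws1'.
  by rewrite z1 ltxx.
move: (IH ws1') q0; set q := \prod_(w <- ws) _ => {}IH q0.
have -> : z * (\prod_(w <- w :: ws) ('X - w%:P))^`().[z] / (\prod_(w <- w :: ws) ('X - w%:P)).[z]
    = z / (z - w) + z * q^`().[z] / q.[z].
  rewrite big_cons -/q derivM derivXsubC mul1r hornerD !hornerM hornerXsubC.
  by field; rewrite q0 zv.
rewrite rmorphD /= addrACA /= -natr1 addrC; apply: lerD => //.
have zzb : z * z^* = 1 by rewrite -normCK z1 expr1n.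
rewrite -subr_ge0 rmorphM fmorphV rmorphB /=.
have zwb : z^* - w^* != 0 by rewrite -rmorphB conjC_eq0 zv.
rewrite [X in 0 <= X](_ : _ = (w * w^* - z * z^*) / ((z - w) * (z^* - w^*))); last first.
  by field; rewrite zwb zv.
rewrite zzb -rmorphB -!normCK divr_ge0 ?exprn_ge0 ?subr_ge0 //.
by rewrite exprn_ege1 // ltW.
Qed.

Lemma root_self_inversive N s :
    (2 * (size s).-1 < N)%N -> (forall z, `|z| <= 1 -> ~~ root s z) ->
  (forall z, root (s + conj_rev N s) z -> `|z| = 1) /\ separable_poly (s + conj_rev N s).
Proof.
move=> lt_sN s_nz; set P := s + _.
have s0 : s.[0] != 0 by rewrite s_nz // normr0.
have sn0 : s != 0 by apply: contraNneq s0 => ->; rewrite horner0.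
have [ws def_s] := closed_field_poly_normal s.
have lc0 : lead_coef s != 0 by rewrite lead_coef_eq0.
have ws1 w : w \in ws -> 1 < `|w|.
  move=> w_ws; rewrite real_ltNge ?normr_real ?real1 //; apply/negP => /s_nz.
  by rewrite def_s rootZ // root_prod_XsubC w_ws.
have size_s : size s = (size ws).+1 by rewrite def_s size_scale // size_prod_XsubC.
have lt_wsN : (size ws < N)%N by move: lt_sN; rewrite size_s /=; lia.
have le_sN : (size s <= N.+1)%N by rewrite size_s ltnS ltnW.
have in_disc z : z != 0 -> `|z| < 1 -> s.[z] + z ^+ N * (s.[(z^*)^-1])^* != 0.
  move=> z0 z1; rewrite addr_eq0; apply/negP => /eqP /(congr1 Num.norm); apply/eqP.
  rewrite eq_sym normrN normrM norm_conjC normrX lt_eqF //.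
  have sz0 : 0 < `|s.[z]| by rewrite normr_gt0 -rootE s_nz // ltW.
  have le_s : `|z| ^+ size ws * `|s.[(z^*)^-1]| <= `|s.[z]|.
    rewrite def_s !hornerZ !normrM mulrCA ler_wpM2l // .
    exact: norm_prod_reflect_le.
  (* The inequality is strict because the surplus factor |z|^(N - size ws) is less than 1 and s(z)
     is nonzero. *)
  rewrite -(subnK (_ : size ws <= N)%N); last by lia.
  rewrite exprD -mulrA; apply: le_lt_trans (_ : `|z| ^+ (N - size ws) * `|s.[z]| < _).
    by rewrite ler_wpM2l ?exprn_ge0.
  rewrite -[ltRHS]mul1r ltr_pM2r // exprn_ilt1 //; lia.
have P0 : P.[0] != 0.
  rewrite hornerD !horner_coef0. rewrite coef_poly /= subn0 [s`_N]nth_default ?size_s //.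
  by rewrite conjC0 addr0 -horner_coef0.
have evalP z : z != 0 -> P.[z] = s.[z] + z ^+ N * (s.[(z^*)^-1])^*.
  by move=> z0; rewrite hornerD horner_conj_rev.
have circle z : root P z -> `|z| = 1.
  move=> Pz; have z0 : z != 0 by apply: contraTneq Pz => ->.
  move: Pz; rewrite /root evalP // => Pz.
  have : z^* != 0 by rewrite conjC_eq0.
  have [z1|z1|//] := real_ltgtP (normr_real z) (real1 C).
    by rewrite (negPf (in_disc z z0 z1)) in Pz.
  (* By self-inversiveness, a root z outside the disc would give the root 1/conj z inside it. *)
  move=> zb0; have u1 : `|(z^*)^-1| < 1 by rewrite normfV norm_conjC invf_lt1 // (lt_trans ltr01).
  have /negP[] := in_disc _ (invr_neq0 zb0) u1.
  rewrite fmorphV /= conjCK invrK -conjC_eq0 rmorphD rmorphM rmorphXn /= fmorphV /= !conjCK.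
  have zN : z ^+ N != 0 by rewrite expf_neq0.
  rewrite -(mulrI_eq0 _ (mulfI zN)) mulrDr exprVn mulVKf // addrC.
  by [].
split=> //; rewrite unlock.
(* A double root z would give 2 Re (z s'(z)/s(z)) = N, whereas each root w of s, being
   outside the disc, contributes at most 1 to this quantity. *)
apply/Pdiv.ClosedField.coprimepP => z /[dup] Pz /circle z1; apply/negP => /eqP P'z.
have z0 : z != 0 by rewrite -normr_gt0 z1.
have zb : (z^*)^-1 = z by rewrite -[z^*]mulr1 -(mulfV z0) mulrA (mulrC _ z) -normCK z1 expr1n mul1r invrK.
have sz0 : s.[z] != 0 by rewrite -rootE s_nz // z1.
(* At a double root the reversed polynomial and its derivative take the values -s(z) and -s'(z).
   With A = z s'(z), [deriv_conj_rev] then reads A = N s(z) + z^N conj A; division by s(z) = -z^N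
   conj s(z) gives 2 Re(A/s(z)) = N. *)
have Qz : (conj_rev N s).[z] = - s.[z].
  by apply/eqP; rewrite -addr_eq0 addrC -hornerD; exact: Pz.
have zN : z ^+ N * (s.[z])^* = - s.[z] by rewrite -Qz horner_conj_rev // zb.
have := congr1 (horner^~ z) (deriv_conj_rev N s) => /=.
rewrite hornerM hornerX hornerD hornerN hornerMn Qz horner_conj_rev //; last first.
  apply: leq_trans (size_polyMleq _ _) _; rewrite size_polyX /=.
  by apply: leq_trans le_sN; apply: lt_size_deriv.
move/eqP: P'z; rewrite derivD hornerD addr_eq0 -eqr_oppLR => /eqP <-.
rewrite zb hornerM hornerX; set A := z * s^`().[z] => eqA.
have := logderiv_disc_le ws1 z1; rewrite /=.
have -> : z * (\prod_(w <- ws) ('X - w%:P))^`().[z] / (\prod_(w <- ws) ('X - w%:P)).[z]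
    = A / s.[z].
  have := sz0; rewrite /A {1 2 3}def_s derivZ !hornerZ mulf_eq0 negb_or => /andP[_ q0].
  by rewrite mulrCA -mulf_div divff // mul1r.
have szb0 : (s.[z])^* != 0 by rewrite conjC_eq0.
suff -> : A / s.[z] + (A / s.[z])^* = N%:R by rewrite ler_nat leqNgt lt_wsN.
rewrite rmorphM fmorphV /=.
move: eqA; rewrite mulrN -/A -mulr_natr => /eqP; rewrite -subr_eq0 => /eqP eqA.
move: A (s.[z]) (s.[z]^* ) (A^* ) (z ^+ N) (N%:R : C) sz0 szb0 zN eqA => A' x y B t k x0 y0 tN eqA.
have -> : A' / x + B / y = (A' * y + x * B) / (x * y) by field; rewrite x0 y0.
rewrite (_ : A' * y + x * B = k * (x * y)) ?mulfK ?mulf_neq0 //.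
apply/eqP; rewrite -subr_eq0; apply/eqP.
have tN' : t * y + x = 0 by rewrite tN addNr.
have -> : A' * y + x * B - k * (x * y)
  = (t * y + x) * B - (- A' - (- x * k - t * B)) * y by ring.
by rewrite tN' eqA !mul0r subrr.
Qed.

End SelfInversive.

(** * Sums of absolute values of coefficients, discrete Parseval identity *)

Section WienerNorm.
Variable K : numDomainType.
Implicit Types p q : {poly K}.

(** The norm of the Wiener algebra: it is submultiplicative and dominates the supremum on the closed
    disc. *)
Definition wnorm p : K := \sum_(i < size p) `|p`_i|.

Lemma wnorm_wide n p : (size p <= n)%N -> wnorm p = \sum_(i < n) `|p`_i|.
Proof.
move=> le_pn; rewrite /wnorm (big_ord_widen n (fun i => `|p`_i|) le_pn) big_mkcond.
by apply: eq_bigr => i _; case: ltnP => // /(nth_default 0) ->; rewrite normr0.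
Qed.

Lemma wnorm_ge0 p : 0 <= wnorm p.
Proof. exact: sumr_ge0. Qed.

Lemma wnormD p q : wnorm (p + q) <= wnorm p + wnorm q.
Proof.
rewrite (wnorm_wide (size_polyD p q)) (wnorm_wide (leq_maxl _ (size q))).
rewrite (wnorm_wide (leq_maxr (size p) _)) -big_split /=.
by apply: ler_sum => i _; rewrite coefD ler_normD.
Qed.

Lemma wnormMXaddC p c : wnorm (p * 'X + c%:P) = wnorm p + `|c|.
Proof.
rewrite (@wnorm_wide (size p).+1); last first.
  by rewrite size_MXaddC; case: ifP.
rewrite big_ord_recl addrC; congr (_ + _); last by rewrite coefD coefMX coefC add0r.
by apply: eq_bigr => i _; rewrite coefD coefMX coefC addr0.
Qed.

Lemma wnormC c : wnorm c%:P = `|c|.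
Proof. by rewrite -[c%:P]add0r -(mul0r 'X) wnormMXaddC /wnorm size_poly0 big_ord0 add0r. Qed.

Lemma wnormZ c p : wnorm (c *: p) <= `|c| * wnorm p.
Proof.
rewrite (wnorm_wide (size_scale_leq c p)) mulr_sumr.
by apply: ler_sum => i _; rewrite coefZ normrM.
Qed.

Lemma wnormM p q : wnorm (p * q) <= wnorm p * wnorm q.
Proof.
elim/poly_ind: p => [|p c IH]; first by rewrite mul0r wnormC normr0 mul0r.
rewrite wnormMXaddC mulrDl mulrAC mul_polyC (le_trans (wnormD _ _)) //.
rewrite -[p * q * 'X]addr0 -polyC0 wnormMXaddC normr0 addr0 mulrDl lerD //.
exact: wnormZ.
Qed.

Lemma wnormXn p n : wnorm (p ^+ n) <= wnorm p ^+ n.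
Proof.
elim: n => [|n IH]; first by rewrite !expr0 -polyC1 wnormC normr1.
by rewrite !exprS (le_trans (wnormM _ _)) // ler_wpM2l // wnorm_ge0.
Qed.

Lemma norm_horner_le p z : `|z| <= 1 -> `|p.[z]| <= wnorm p.
Proof.
move=> z1; rewrite horner_coef (le_trans (ler_norm_sum _ _ _)) //.
apply: ler_sum => i _; rewrite normrM normrX ler_piMr // exprn_ile1 //.
Qed.

Lemma wnorm_le_coef p q : (forall i, `|p`_i| <= `|q`_i|) -> wnorm p <= wnorm q.
Proof.
move=> le_pq; rewrite (wnorm_wide (leq_maxl _ (size q))).
by rewrite (wnorm_wide (leq_maxr (size p) _)); apply: ler_sum.
Qed.

End WienerNorm.

Section Parseval.
Variable C : numClosedFieldType.

Lemma prim_root_exists n : (0 < n)%N -> exists z : C, n.-primitive_root z.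
Proof.
pose p : {poly C} := 'X^n - 1; have [r Dp] := closed_field_poly_normal p.
move=> n_gt0; rewrite (monicP _) ?monicXnsubC // scale1r in Dp.
have rn1 : all n.-unity_root r by apply/allP => z; rewrite -root_prod_XsubC -Dp.
have sz_r : (n < (size r).+1)%N by rewrite -(size_prod_XsubC r id) -Dp size_XnsubC.
have [|z] := hasP (has_prim_root n_gt0 rn1 _ sz_r); last by exists z.
by rewrite -separable_prod_XsubC -Dp separable_Xn_sub_1 // pnatr_eq0 -lt0n.
Qed.

(** Orthogonality of the characters of Z/n; the bound on the size of [p] prevents two degrees from
    being congruent modulo n. *)
Lemma parseval_root_unity n (w : C) (p : {poly C}) :
    n.-primitive_root w -> (size p <= n)%N ->
  \sum_(t < n) `|p.[w ^+ t]| ^+ 2 = n%:R * \sum_(k < n) `|p`_k| ^+ 2.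
Proof.
move=> prim_w le_pn; have n_gt0 := prim_order_gt0 prim_w.
have w1 : w * w^* = 1.
  apply/eqP; rewrite -normCK sqrp_eq1 // -(pexpr_eq1 n_gt0) // -normrX.
  by rewrite (prim_expr_order prim_w) normr1.
have w0 : w != 0 by apply: contra_eq_neq w1 => ->; rewrite mul0r eq_sym oner_neq0.
have orth (k l : 'I_n) : \sum_(t < n) (w ^+ t) ^+ k * ((w ^+ t) ^+ l)^* = (n * (k == l))%:R.
  (* x stands for w^(k - l); for k distinct from l it is an n-th root of unity other than 1, so its
     geometric sum vanishes. *)
  pose x := w ^+ k * (w^*) ^+ l.
  have xn : x ^+ n = 1.
    rewrite exprMn -!exprM mulnC exprM (prim_expr_order prim_w) expr1n mul1r mulnC exprM.
    by rewrite -rmorphXn /= (prim_expr_order prim_w) conjC1 expr1n.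
  rewrite (eq_bigr (fun t : 'I_n => x ^+ t)); last first.
    by move=> t _; rewrite !rmorphXn /= exprMn -!exprM ![(t * _)%N]mulnC.
  have [eq_kl|neq_kl] := eqVneq k l.
    by rewrite /x -eq_kl -exprMn w1 expr1n muln1 (eq_bigr (fun=> 1)) ?sumr_const ?card_ord // => t _; rewrite expr1n.
  have x1 : x - 1 != 0.
    rewrite subr_eq0; apply: contra neq_kl => /eqP /(congr1 (fun y => y * w ^+ l)).
    rewrite mul1r /x -mulrA -exprMn (mulrC _ w) w1 expr1n mulr1 => /eqP.
    by rewrite (eq_prim_root_expr prim_w) !modn_small.
  by apply: (mulfI x1); rewrite -subrX1 xn subrr muln0 mulr0.
under eq_bigr => t _.
  rewrite normCK (horner_coef_wide _ le_pn) rmorph_sum mulr_suml.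
  under eq_bigr => k _.
    rewrite mulr_sumr.
    under eq_bigr => l _ do rewrite rmorphM mulrACA.
  over.
over.
rewrite exchange_big mulr_sumr; apply: eq_bigr => k _ /=.
rewrite exchange_big (bigD1 k) //= -mulr_sumr orth eqxx muln1 -normCK mulrC big1 ?addr0 //.
by move=> l neq_lk; rewrite -mulr_sumr orth eq_sym (negPf neq_lk) muln0 mulr0.
Qed.

Lemma sum_sqr_coef_le (p : {poly C}) B : 0 <= B ->
  (forall z, `|z| = 1 -> `|p.[z]| <= B) -> \sum_(k < size p) `|p`_k| ^+ 2 <= B ^+ 2.
Proof.
move=> B0 le_pB; case: (posnP (size p)) => [->|n_gt0].
  by rewrite big_ord0 exprn_ge0.
have [w prim_w] := prim_root_exists n_gt0.
have n0 : 0 < (size p)%:R :> C by rewrite ltr0n.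
rewrite -(ler_pM2l n0) -(parseval_root_unity prim_w) //.
rewrite -[X in _ <= X%:R * _]card_ord mulr_natl -sumr_const ler_sum // => t _.
rewrite ler_sqr ?nnegrE // le_pB // normrX.
suff -> : `|w| = 1 by rewrite expr1n.
apply/eqP; rewrite -(pexpr_eq1 n_gt0) // -normrX.
by rewrite (prim_expr_order prim_w) normr1.
Qed.

End Parseval.

(** * Coefficients of bounded power series *)

(** A partial sum within [d] of the supremum of all partial sums leaves at most [d] for any later
    block. *)
Lemma summable_tail (R : realType) (u : nat -> R) B :
    (forall k, 0 <= u k) -> (forall K, \sum_(k < K) u k <= B) ->
  forall d, 0 < d -> exists K, forall L, (K <= L)%N -> \sum_(K <= k < L) u k <= d.
Proof.
move=> u0 uB d d0; pose E := range (fun K => \sum_(k < K) u k).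
have supE : has_sup E.
  split; first by exists (\sum_(k < 0) u k), 0%N.
  by exists B => _ [K _ <-].
have [_ [K _ <-] ltK] := sup_adherent d0 supE.
exists K => L le_KL; have : \sum_(k < L) u k <= sup E by apply: ub_le_sup (supE.2) _ _; exists L.
rewrite -[X in X <= _](big_mkord xpredT u) (big_cat_nat (n := K)) //= big_mkord.
by move: ltK; lra.
Qed.

Lemma sum_exp_coeff_le (R : realType) (x : R) n : 0 <= x ->
  \sum_(k < n) x ^+ k / k`!%:R <= expR x.
Proof.
move=> x0; rewrite -(big_mkord xpredT (fun k => x ^+ k / k`!%:R)).
apply: (nondecreasing_cvgn_le (u_ := series (exp_coeff x))); last exact: is_cvg_series_exp_coeff.
by apply: nondecreasing_series => k _ _; apply: exp_coeff_ge0.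
Qed.

Section BoundedCoefficients.
Variables (R : realType) (a : nat -> R[i]) (f : R[i] -> R[i]) (M : R).
Hypothesis f_series : forall z : R[i], `|z| < 1 ->
  series (fun j => - a j * z ^+ j) @ \oo --> f z.
Hypothesis f_bounded : forall z : R[i], `|z| < 1 -> `|f z| <= (M%:C)%C.
Local Open Scope complex_scope.

Lemma norm_realC (x : R) : 0 <= x -> `|x%:C| = x%:C.
Proof. by move=> x0; rewrite ger0_norm // ler0c. Qed.

Lemma coef_geometric_decay (r : R) : 0 < r -> r < 1 ->
  exists k0, forall k, (k0 <= k)%N -> `|a k| * r%:C ^+ k <= 1.
Proof.
move=> r0 r1; have normr : `|r%:C| = r%:C by rewrite norm_realC // ltW.
have /f_series/cvgP/cvg_series_cvg_0/cvgr0Pnorm_lt : `|r%:C| < 1.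
  by rewrite normr ltcR.
move=> /(_ _ ltr01)[k0 _ small]; exists k0 => k /small /=.
by rewrite normrM normrN normrX normr => /ltW.
Qed.

(** The hypothesis on f gives only pointwise convergence, while [L] must serve all z on the circle.
    With r < r' < 1, decay at radius r' bounds the terms by q^k, q = r/r', uniformly in z. *)
Lemma partial_sum_bounded (r : R) K : 0 < r -> r < 1 -> exists2 L, (K <= L)%N &
  forall z : R[i], `|z| = 1 ->
    `|(\poly_(k < L) (- a k * r%:C ^+ k)).[z]| <= (M + 1)%:C.
Proof.
move=> r0 r1; pose r' := (1 + r) / 2; pose q := r / r'.
have r'0 : 0 < r' by rewrite /r'; lra.
have r'1 : r' < 1 by rewrite /r'; lra.
have q0 : 0 <= q by rewrite divr_ge0 // ltW.
have q1 : q < 1 by rewrite ltr_pdivrMr // mul1r /r'; lra.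
have [k0 small] := coef_geometric_decay r'0 r'1.
(* This threshold makes the geometric tail q^L/(1 - q) at most 1/2. *)
have [k1 qsmall] : exists k1, forall k, (k1 <= k)%N -> q ^+ k <= (1 - q) / 2.
  have /cvgr0Pnorm_lt : (GRing.exp q : nat -> R) @ \oo --> 0 by apply: cvg_expr; rewrite ger0_norm.
  have d0 : 0 < (1 - q) / 2 by lra.
  by move=> /(_ _ d0)[k1 _ H]; exists k1 => k /H /= /ltW; apply: le_trans; rewrite ler_norm.
pose L := maxn K (maxn k0 k1); exists L; first exact: leq_maxl.
move=> z z1; pose u k := - a k * (r%:C * z) ^+ k.
have sumE n : (\poly_(k < n) (- a k * r%:C ^+ k)).[z] = series u n.
  rewrite horner_poly /series /= big_mkord; apply: eq_bigr => k _.
  by rewrite /u exprMn mulrA.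
have nz : `|r%:C * z| < 1 by rewrite normrM z1 mulr1 norm_realC ?ltcR // ltW.
have half0 : 0 < (1 / 2 : R)%:C by rewrite ltcR; lra.
have /cvgrPdist_lt/(_ _ half0)[L1 _ near_f] := f_series nz.
(* [L'] may depend on z: its sum is within 1/2 of f(rz), and within 1/2 of the sum up to [L]. *)
pose L' := maxn L L1; have le_LL' : (L <= L')%N by exact: leq_maxl.
have norm_u k : (L <= k)%N -> `|u k| <= (q ^+ k)%:C.
  move=> le_Lk; rewrite normrM normrN normrX normrM z1 mulr1 norm_realC ?(ltW r0) //.
  have -> : r%:C = (q * r')%:C by rewrite /q divfK // gt_eqF.
  rewrite rmorphM exprMn mulrCA rmorphXn ler_piMr ?exprn_ge0 ?ler0c //.
  by apply: small; apply: leq_trans le_Lk; rewrite /L !leq_max leqnn orbT.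
have tail : `|series u L' - series u L| <= (1 / 2 : R)%:C.
  rewrite sub_series_geq // (le_trans (ler_norm_sum _ _ _)) //.
  apply: (@le_trans _ _ (\sum_(L <= k < L') (q ^+ k)%:C)).
    by rewrite !big_nat; apply: ler_sum => k /andP[/norm_u].
  rewrite -rmorph_sum lecR.
  have geom n : (L <= n)%N -> (1 - q) * \sum_(L <= k < n) q ^+ k = q ^+ L - q ^+ n.
    move=> le_Ln; rewrite mulr_sumr; rewrite (eq_bigr (fun k => - (q ^+ k.+1 - q ^+ k))); last first.
      by move=> k _; rewrite exprS; ring.
    by rewrite sumrN telescope_sumr // opprB.
  rewrite -(ler_pM2l (_ : 0 < 1 - q)); last by rewrite subr_gt0.
  rewrite geom //; have : q ^+ L <= (1 - q) / 2.
    by apply: qsmall; rewrite /L !leq_max leqnn !orbT.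
  by have := exprn_ge0 L' q0; lra.
rewrite sumE -(subKr (series u L') (series u L)).
apply: le_trans (ler_normB _ _) _.
rewrite (_ : M + 1 = (M + 1 / 2) + 1 / 2) ?rmorphD; last by lra.
apply: lerD => //; rewrite -(subKr (f (r%:C * z)) (series u L')).
apply: le_trans (ler_normB _ _) _; apply: lerD; first exact: f_bounded.
by apply: ltW; apply: near_f; rewrite /= leq_maxr.
Qed.

(** Parseval bounds the sum of |a_k|^2 r^(2k) by (M + 1)^2; the factor 2 pays for removing
    r^(2k). *)
Lemma sum_sqr_coef_bounded K : \sum_(k < K) `|a k| ^+ 2 <= (2 * (M + 1) ^+ 2)%:C.
Proof.
have M0 : 0 <= M.
  have : `|0 : R[i]| < 1 by rewrite normr0.
  by move=> /f_bounded /(le_trans (normr_ge0 _)); rewrite ler0c.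
(* r is chosen so that r^(2k) >= 1/2 for k < K. *)
pose t : R := (4 * K.+1%:R)^-1; pose r : R := 1 - t.
have K0 : 1 <= K.+1%:R :> R by rewrite ler1n.
have /andP[K4 K4'] : 0 < t <= 4^-1.
  rewrite /t invr_gt0 mulr_gt0 ?ltr0Sn //= lef_pV2 ?posrE ?mulr_gt0 ?ltr0Sn //.
  by rewrite ler_peMr.
have r0 : 0 < r by rewrite /r; move: (t) K4 K4' => x; lra.
have r1 : r < 1 by rewrite /r; move: (t) K4 K4' => x; lra.
have [L le_KL le_f] := partial_sum_bounded K r0 r1.
have bern n : 1 - n%:R * (1 - r) <= r ^+ n.
  elim: n => [|n IH]; first by rewrite mul0r subr0.
  rewrite exprS -natr1; have : 0 <= n%:R * (1 - r) * (1 - r).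
    by rewrite !mulr_ge0 // subr_ge0 ltW.
  have : r * (1 - n%:R * (1 - r)) <= r * r ^+ n by rewrite ler_wpM2l // ltW.
  by lra.
have rk k : (k < K)%N -> 1 / 2 <= (r ^+ k) ^+ 2.
  move=> lt_kK; rewrite -exprM; apply: le_trans (bern _).
  rewrite /r opprB addrCA subrr addr0.
  suff : (k * 2)%:R * t <= 1 / 2 by move: (_ * t) => x; lra.
  rewrite /t.
  rewrite ler_pdivrMr ?mulr_gt0 ?ltr0Sn // mulrA.
  have -> : 1 / 2 * 4 = 2 :> R by lra.
  by rewrite natrM mulrC ler_pM2l // ler_nat ltnW // ltnW.
set p := \poly_(k < L) _ in le_f.
have B0 : 0 <= (M + 1)%:C by rewrite ler0c; lra.
have := sum_sqr_coef_le B0 le_f; rewrite -[X in X <= _](_ : \sum_(k < L) `|p`_k| ^+ 2 = _); last first.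
  rewrite (big_ord_widen _ (fun k => `|p`_k| ^+ 2) (size_poly _ _)) [RHS]big_mkcond /=.
  by apply: eq_bigr => k _; case: ltnP => // /(nth_default 0) ->; rewrite normr0 expr0n.
move=> le_p; have {}le_p : \sum_(k < K) `|p`_k| ^+ 2 <= (M + 1)%:C ^+ 2.
  apply: le_trans le_p; rewrite (big_ord_widen _ (fun k => `|p`_k| ^+ 2) le_KL) big_mkcond /=.
  by apply: ler_sum => k _; case: ifP => // _; rewrite exprn_ge0.
rewrite rmorphM rmorphXn /= -ler_pdivrMl ?ltcR //.
apply: le_trans le_p; rewrite mulr_sumr; apply: ler_sum => k _.
rewrite coef_poly (leq_trans (ltn_ord k) le_KL) normrM normrN normrX norm_realC ?(ltW r0) //.
rewrite exprMn mulrC ler_wpM2l ?exprn_ge0 // -fmorphV -!rmorphXn lecR.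
by have := rk k (ltn_ord k); rewrite mul1r.
Qed.

End BoundedCoefficients.

(** * Absence of zeros of the Taylor polynomials *)

Section ZeroFree.
Variables (R : realType) (B : R).
Local Open Scope complex_scope.
Implicit Type a : nat -> R[i].

Definition square_summable a := forall K, \sum_(k < K) `|a k| ^+ 2 <= B%:C.

(** [A] bounds the sum of |a_k|/(k+1): each term is at most half of |a_k|^2 + (k+1)^-2, and the
    inverse squares add up to at most 2. [E] then bounds the Wiener norm of the truncated
    exponential. *)
Let A := (B + 2) / 2.
Let E := expR A.

Lemma sum_inv_sqr_le2 (F : realFieldType) K : \sum_(k < K) (k.+1%:R ^- 2 : F) <= 2.
Proof.
(* The induction needs this sharper bound, which telescopes. *)
suff le2 : \sum_(k < K.+1) (k.+1%:R ^- 2 : F) <= 2 - K.+1%:R^-1.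
  apply: le_trans (le_trans le2 _); last by rewrite gerBl invr_ge0.
  by rewrite big_ord_recr /= lerDl invr_ge0 exprn_ge0.
elim: K => [|K IH]; first by rewrite big_ord_recl big_ord0 expr1n invr1; lra.
rewrite big_ord_recr /=; apply: le_trans (lerD IH (lexx _)) _.
rewrite -[K.+2%:R]natr1; move: (K.+1%:R : F) (ltr0Sn F K) => x x0.
have x1 : 0 < x + 1 by lra.
rewrite -subr_ge0 [X in 0 <= X](_ : _ = (x * (x + 1) ^+ 2)^-1).
  by rewrite invr_ge0 mulr_ge0 ?exprn_ge0 // ltW.
by field; rewrite !gt_eqF.
Qed.

Lemma sum_coef_primitive_le a K : square_summable a ->
  \sum_(k < K) `|a k| / k.+1%:R <= A%:C.
Proof.
move=> a2; apply: (@le_trans _ _ (\sum_(k < K) (`|a k| ^+ 2 + (k.+1%:R^-1) ^+ 2) / 2)).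
  apply: ler_sum => k _; apply: real_leif_mean_square; first exact: normr_real.
  by rewrite ger0_real // invr_ge0.
rewrite -mulr_suml big_split /= /A rmorphM fmorphV rmorphD !rmorph_nat /=.
rewrite ler_pM2r ?invr_gt0 ?ltr0n //; apply: lerD; first exact: a2.
rewrite (eq_bigr (fun k : 'I_K => (k.+1%:R ^- 2 : R)%:C)); last first.
  by move=> k _; rewrite fmorphV rmorphXn rmorph_nat exprVn.
by rewrite -rmorph_sum -(rmorph_nat (real_complex R) 2) lecR sum_inv_sqr_le2.
Qed.

Lemma wnorm_prim_trunc a n : square_summable a -> wnorm (prim_trunc a n) <= A%:C.
Proof.
move=> a2; rewrite (wnorm_wide (size_poly _ _)) big_ord_recl coef_poly /= normr0 add0r.
apply: le_trans (sum_coef_primitive_le n a2); apply: ler_sum => k _.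
by rewrite coef_poly ltnS ltn_ord /= normrM normrN normfV normr_nat.
Qed.

Lemma bound_ge0 a : square_summable a -> 0 <= A.
Proof. by move=> /(sum_coef_primitive_le 0); rewrite big_ord0 ler0c. Qed.

Lemma wnorm_s_poly a n : square_summable a -> wnorm (s_poly a n) <= E%:C.
Proof.
move=> a2; have A0 := bound_ge0 a2.
apply: (@le_trans _ _ (\sum_(k < n.+1) wnorm (prim_trunc a n ^+ k) / k`!%:R)).
  rewrite (wnorm_wide (size_poly _ _)).
  apply: (@le_trans _ _ (\sum_(i < n.+1) \sum_(k < n.+1) `|(prim_trunc a n ^+ k)`_i| / k`!%:R)).
    apply: ler_sum => i _; rewrite coef_poly ltn_ord (le_trans (ler_norm_sum _ _ _)) //.
    by apply: ler_sum => k _; rewrite normrM normfV normr_nat.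
  rewrite exchange_big; apply: ler_sum => k _ /=; rewrite -mulr_suml.
  rewrite ler_wpM2r ?invr_ge0 ?ler0n //.
  rewrite (wnorm_wide (leq_maxl (size (prim_trunc a n ^+ k)) n.+1)).
  rewrite (big_ord_widen _ (fun i => `|(prim_trunc a n ^+ k)`_i|) (leq_maxr (size (prim_trunc a n ^+ k)) n.+1)).
  by rewrite big_mkcond; apply: ler_sum => i _; case: ifP.
apply: le_trans (_ : (\sum_(k < n.+1) A ^+ k / k`!%:R)%:C <= _); last first.
  by rewrite lecR sum_exp_coeff_le.
rewrite rmorph_sum; apply: ler_sum => k _; rewrite rmorphM fmorphV rmorphXn rmorph_nat /=.
rewrite ler_wpM2r ?invr_ge0 ?ler0n // (le_trans (wnormXn _ _)) //.
by rewrite lerXn2r ?nnegrE ?wnorm_ge0 ?ler0c // wnorm_prim_trunc.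
Qed.

(** [K] is uniform in n: all s_n are truncations of one sequence c_k, whose absolute partial sums
    are bounded by [E]. *)
Lemma s_poly_tail a d : square_summable a -> 0 < d ->
  exists K, forall n, wnorm (s_poly a n - take_poly K (s_poly a n)) <= d%:C.
Proof.
move=> a2 d0; pose c k := (s_poly a k)`_k; pose u k := complex.Re `|c k|.
have uE k : (u k)%:C = `|c k| by rewrite RRe_real ?normr_real.
have u0 k : 0 <= u k by rewrite -ler0c uE.
have uB K : \sum_(k < K) u k <= E.
  rewrite -lecR rmorph_sum; apply: le_trans (wnorm_s_poly K a2).
  rewrite (wnorm_wide (size_poly _ _)) big_ord_recr /= ler_wpDr //.
  apply: ler_sum => k _; rewrite [X in X <= _]uE /c.
  by rewrite (s_poly_coef_stable a (m := K)) // ltnW.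
have [K tailK] := summable_tail u0 uB d0; exists K => n.
rewrite (@wnorm_wide _ (maxn K n.+1)); last first.
  rewrite (leq_trans (size_polyD _ _)) // size_polyN maxnC.
  by rewrite geq_max !leq_max size_take_poly size_s_poly orbT.
apply: (@le_trans _ _ (\sum_(K <= k < maxn K n.+1) u k)%:C); last first.
  by rewrite lecR tailK ?leq_maxl.
rewrite big_geq_mkord rmorph_sum [X in _ <= X]big_mkcond /=.
apply: ler_sum => i _; rewrite coefB coef_take_poly; case: ltnP => [_|le_Ki].
  by rewrite subrr normr0.
rewrite subr0 [X in _ <= X]uE; case: (leqP i n) => [le_in|lt_ni].
  by rewrite /c (s_poly_coef_stable a (m := n)).
by rewrite nth_default ?normr0 // (leq_trans (size_s_poly a n)).
Qed.

(** Changing the sign of a replaces G by 1/G. The derivative of the product vanishes to order n,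
    since the terms in F' and -F' cancel. *)
Lemma s_poly_opp_inverse a n :
  'X^(n.+1) %| s_poly a n * s_poly (fun k => - a k) n - 1.
Proof.
set s := s_poly a n; set t := s_poly _ n.
have FN : prim_trunc (fun k => - a k) n = - prim_trunc a n.
  apply/polyP => i; rewrite coefN !coef_poly; case: ifP => _; last by rewrite oppr0.
  by case: i => [|i]; rewrite ?oppr0 // mulNr.
have dvd_deriv : 'X^n %| (s * t)^`().
  have := dvdp_add (dvdp_mull t (s_poly_deriv a n))
                   (dvdp_mull s (s_poly_deriv (fun k => - a k) n)).
  rewrite -/s -/t FN derivN; apply: etrans; congr (_ %| _).
  by rewrite derivM; ring.
apply/dvdXnP => -[|i] lt_in; rewrite coefB coef1 ?subr0.
  by rewrite coef0M !s_poly_coef0 mulr1 subrr.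
have /dvdXnP/(_ i lt_in) := dvd_deriv; rewrite coef_deriv -mulr_natr => /eqP.
by rewrite mulf_eq0 pnatr_eq0 orbF => /eqP.
Qed.

(** The product s t - 1 has no coefficient up to degree n, and the product of the heads [s1], [t1]
    has none above it. Only tail terms remain, of total norm at most 1/2, whereas at a root of s the
    value is -1. *)
Lemma s_poly_zero_free a : square_summable a ->
  exists n0, forall n, (n0 <= n)%N -> forall z : R[i], `|z| <= 1 -> ~~ root (s_poly a n) z.
Proof.
move=> a2; pose b k := - a k.
have b2 : square_summable b by move=> K; rewrite (eq_bigr (fun k : 'I_K => `|a k| ^+ 2)) ?a2 // => k _; rewrite normrN.
have E0 : 0 < E by exact: expR_gt0.
(* Chosen so that the two error terms E d + d E sum to 1/2. *)
pose d := (4 * E)^-1; have d0 : 0 < d by rewrite invr_gt0 mulr_gt0.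
have [K1 tail1] := s_poly_tail a2 d0; have [K2 tail2] := s_poly_tail b2 d0.
exists (K1 + K2)%N => n le_Kn z z1; apply/negP => sz.
set s := s_poly a n in sz tail1; pose t := s_poly b n.
set s1 := take_poly K1 s; set t1 := take_poly K2 t.
have ws1 : wnorm s1 <= E%:C.
  apply: le_trans (wnorm_s_poly n a2); apply: wnorm_le_coef => i.
  by rewrite coef_take_poly; case: ifP => // _; rewrite normr0.
have small : wnorm (s1 * (t - t1) + (s - s1) * t) <= (1 / 2 : R)%:C.
  have -> : 1 / 2 = E * d + d * E :> R by rewrite /d; field; rewrite gt_eqF.
  rewrite (le_trans (wnormD _ _)) // rmorphD lerD // (le_trans (wnormM _ _)) // rmorphM.
    by apply: ler_pM; rewrite ?wnorm_ge0 // tail2.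
  by apply: ler_pM; rewrite ?wnorm_ge0 ?wnorm_s_poly // tail1.
have : wnorm (s * t - 1) <= (1 / 2 : R)%:C.
  apply: le_trans small; apply: wnorm_le_coef => i; case: (leqP i n) => [le_in|lt_ni].
    have /dvdXnP -> := s_poly_opp_inverse a n; rewrite ?normr0 ?normr_ge0 //.
  have -> : s * t - 1 = (s1 * (t - t1) + (s - s1) * t) + (s1 * t1 - 1) by ring.
  rewrite [X in `|X| <= _]coefD [X in _ + X]nth_default ?addr0 //.
  rewrite (leq_trans (size_polyD _ _)) // size_polyN size_poly1 geq_max.
  apply/andP; split; last exact: leq_ltn_trans lt_ni.
  apply: leq_trans (leq_trans _ lt_ni); first exact: size_polyMleq.
  apply: leq_trans (leq_pred _) _; apply: leq_trans (leqW le_Kn).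
  by rewrite leq_add ?size_take_poly.
move=> /(le_trans (norm_horner_le _ z1)); rewrite hornerD hornerN hornerM (rootP sz).
by rewrite mul0r add0r hornerC normrN normr1 -(rmorph1 (real_complex R)) lecR; lra.
Qed.

Lemma s_poly_coef_vanish a d : square_summable a -> 0 < d ->
  exists K, forall n k, (K <= k)%N -> `|(s_poly a n)`_k| <= d%:C.
Proof.
move=> a2 d0; have [K tailK] := s_poly_tail a2 d0; exists K => n k le_Kk.
apply: le_trans (tailK n).
have -> : (s_poly a n)`_k = (s_poly a n - take_poly K (s_poly a n))`_k.
  by rewrite coefB coef_take_poly ltnNge le_Kk subr0.
set p := _ - _; rewrite (wnorm_wide (leq_maxl (size p) k.+1)).
by rewrite (bigD1 (Ordinal (leq_maxr (size p) k.+1))) //= ler_wpDr // sumr_ge0.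
Qed.

End ZeroFree.

(** * The remainder estimate *)

Section RemainderBound.
Variable R : realFieldType.
Implicit Types r e x : R.

(** In the induction, multiplication by x + e leaves only the surplus x^k binom(k+2,2) e^3. *)
Lemma binomial_three_terms_le x e k : 0 <= x -> 0 <= e ->
  x ^+ k * (x ^+ 2 + k.+2%:R * (x * e) + k.+2%:R * k.+1%:R / 2 * e ^+ 2) <= (x + e) ^+ k.+2.
Proof.
move=> x0 e0; elim: k => [|k IH]; first by rewrite expr0 mul1r; nra.
rewrite [leRHS]exprSr; apply: le_trans (ler_wpM2r (addr_ge0 x0 e0) IH).
rewrite -subr_ge0 -[k.+3%:R]natr1 -[k.+2%:R]natr1; move: (k.+1%:R : R) (ler0n R k.+1) => c c0.
rewrite [X in 0 <= X](_ : _ = x ^+ k * ((c + 1) * c / 2 * e ^+ 3)); last by rewrite [x ^+ k.+1]exprS; field.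
by rewrite !mulr_ge0 ?exprn_ge0 ?addr_ge0 ?invr_ge0.
Qed.

(* The binomial term of degree 1 in [e] alone would give this without the factor 2, which
   is needed: [bound j] below has to beat 2n + 1 + |a_j|. *)
Lemma double_mean_term_le x e j : (0 < j)%N -> 0 <= x -> 0 <= e ->
  2 * j.+1%:R * e * x ^+ j <= (x + e) ^+ j.+1.
Proof.
case: j => // k _ x0 e0; apply: le_trans (binomial_three_terms_le k x0 e0).
rewrite exprSr mulrCA ler_wpM2l ?exprn_ge0 //.
have : 1 <= k.+1%:R :> R by rewrite ler1n.
rewrite -[k.+2%:R]natr1; move: (k.+1%:R : R) => c c1.
(* The square is completed in x; the remainder is nonnegative because c is at least 1. *)
rewrite -subr_ge0 [X in 0 <= X](_ : _ = (x - (c + 1) * e / 2) ^+ 2 + (c + 1) * (c - 1) / 4 * e ^+ 2).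
  apply: addr_ge0; first exact: sqr_ge0.
  have c0 : 0 <= c + 1 by lra.
  have c1' : 0 <= c - 1 by lra.
  by rewrite mulr_ge0 ?sqr_ge0 // divr_ge0 // mulr_ge0.
by field.
Qed.

Variables (r e : R) (n j : nat).
Hypotheses (e0 : 0 < e) (er : e < r) (r1 : r < 1) (n0 : (0 < n)%N).
Let bound k := r ^+ n.+1 * (r - e) ^- k / (2 * e * (1 - r)).

(** With x = r - e, r^(n+1) is at least 2 (n+1) e x^n, so the bound is at least (n+1)/(1 - r). *)
Lemma lt_bound_diag : n.+1%:R < bound n.
Proof.
have r0 : 0 < r := lt_trans e0 er; have x0 : 0 < r - e by rewrite subr_gt0.
have s0 : 0 < 1 - r by rewrite subr_gt0.
rewrite /bound ltr_pdivlMr ?mulr_gt0 // ltr_pdivlMr ?exprn_gt0 //.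
have le2 := double_mean_term_le n0 (ltW x0) (ltW e0); rewrite subrK in le2.
apply: le_lt_trans (_ : _ <= r ^+ n.+1 * (1 - r)) _.
  apply: le_trans (ler_wpM2r (ltW s0) le2); rewrite le_eqVlt; apply/orP; left.
  by apply/eqP; ring.
by rewrite gtr_pMr ?exprn_gt0 // ltrBlDr ltrDl.
Qed.

(** For j > n, r^(n+1) is at least r^(j+1)/r, so the bound is at least (j+1)/(r (1 - r)), and r (1 -
    r) is at most 1/4. *)
Lemma le_bound_above : (n < j)%N -> 4 * j.+1%:R <= bound j.
Proof.
move=> lt_nj; have j0 := leq_ltn_trans (leq0n n) lt_nj.
have r0 : 0 < r := lt_trans e0 er; have x0 : 0 < r - e by rewrite subr_gt0.
have s0 : 0 < 1 - r by rewrite subr_gt0.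
rewrite /bound ler_pdivlMr ?mulr_gt0 // ler_pdivlMr ?exprn_gt0 //.
have le2 := double_mean_term_le j0 (ltW x0) (ltW e0); rewrite subrK in le2.
apply: (@le_trans _ _ (r ^+ j.+1 * (4 * (1 - r)))).
  have s4 : 0 <= 4 * (1 - r) by rewrite mulr_ge0 // ltW.
  apply: le_trans (ler_wpM2r s4 le2); rewrite le_eqVlt; apply/orP; left.
  by apply/eqP; ring.
apply: (@le_trans _ _ (r ^+ n.+2 * (4 * (1 - r)))).
  by rewrite ler_wpM2r ?mulr_ge0 ?(ltW s0) // ler_wiXn2l ?ltW.
rewrite exprSr -mulrA; apply: ler_piMr; first by rewrite exprn_ge0 // ltW.
have := sqr_ge0 (2 * r - 1); nra.
Qed.

End RemainderBound.

(** * Choice of the threshold and assembly of the estimates *)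

Theorem theorem1p1 (R : realType) (a : nat -> R[i]) (f : R[i] -> R[i])
  (f_series : forall z : R[i], `|z| < 1 ->
     series (fun j => - a j * z ^+ j) @ \oo --> f z)
  (f_bounded : exists M : R, forall z : R[i], `|z| < 1 -> `|f z| <= (M%:C)%C)
  (n0 : nat) (Hn0 : is_n0 a n0) :
  (exists n1 : nat, (n0 <= n1)%N /\
    forall n : nat, (n1 <= n)%N ->
      exists zs : seq R[i],
        [/\ size zs = (2 * n + 1)%N,
            P_poly a n = lead_coef (P_poly a n) *: \prod_(z <- zs) ('X - z%:P),
            uniq zs,
            (forall z, z \in zs -> `|z| = 1) &
            let lam := [seq z^-1 | z <- zs] in
            [/\ uniq lam,
                (forall l, l \in lam -> `|l| = 1),
                (forall j : nat, (j < n)%N -> psum lam j.+1 - a j = 0) &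
                (forall (r e : R), 0 < e -> e < r -> r < 1 ->
                  forall j : nat, (n <= j)%N ->
                    `|psum lam j.+1 - a j| <
                      (r ^+ n.+1 * (r - e) ^- j / (2 * e * (1 - r)))%:C%C)]])
  /\
  (forall n : nat, (n0 <= n)%N ->
     forall zs : seq R[i],
       P_poly a n = lead_coef (P_poly a n) *: \prod_(z <- zs) ('X - z%:P) ->
       forall j : nat, (j < n)%N ->
         psum [seq z^-1 | z <- zs] j.+1 - a j = 0).
Proof.
split=> [|n _ zs defP j lt_jn]; last by rewrite (psum_P_poly defP lt_jn) subrr.
have [M f_le] := f_bounded; have a2 := sum_sqr_coef_bounded f_series f_le.
set B := 2 * (M + 1) ^+ 2 in a2.
have [nz s_nz] := s_poly_zero_free a2.
have half0 : 0 < 1 / 2 :> R by lra.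
have [nv s_small] := s_poly_coef_vanish a2 half0.
have B0 : 0 <= B by rewrite mulr_ge0 ?sqr_ge0.
(* [T] is an integer bound for all |a_j|, through |a_j| <= |a_j|^2 + 1. *)
pose T := Num.bound (B + 1).
have a_le j : `|a j| <= T%:R.
  have B1 : 0 <= B + 1 by rewrite addr_ge0.
  have le_T : (B + 1)%:C%C <= T%:R :> R[i].
    by rewrite -(rmorph_nat (real_complex R) T) lecR ltW // archi_boundP.
  apply: le_trans le_T; have aj2 : `|a j| ^+ 2 <= B%:C%C.
    apply: le_trans (a2 j.+1); rewrite big_ord_recr /=; apply: ler_wpDl (lexx _).
    by apply: sumr_ge0 => k _; exact: exprn_ge0.
  rewrite rmorphD rmorph1; apply: (@le_trans _ _ (`|a j| ^+ 2 + 1)); last by rewrite lerD2r.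
  have := (real_leif_mean_square (normr_real (a j)) (real1 R[i])).1.
  rewrite mulr1 expr1n => /le_trans; apply.
  by rewrite ler_pdivrMr // ler_peMr ?addr_ge0 ?exprn_ge0 // ler1n.
(* [nz] gives absence of zeros, [nv] coefficients at most 1/2, [T] the case j > n; the successor
   ensures n > 0. *)
exists (n0 + nz + nv + T).+1; split; first by lia.
move=> n le_n; set P := P_poly a n.
have size_P : size P = (2 * n + 2)%N := size_P_poly a n.
have [zs defP] := closed_field_poly_normal P.
have lcP : lead_coef P != 0 by rewrite lead_coef_eq0 -size_poly_gt0 size_P addnS.
have size_zs : size zs = (2 * n + 1)%N.
  by apply: succn_inj; rewrite -(size_prod_XsubC zs id) -(size_scale _ lcP) -defP size_P addnS.
have lt_sN : (2 * (size (s_poly a n)).-1 < 2 * n + 1)%N.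
  by have := size_s_poly a n; lia.
have [circleP sepP] : (forall z, root P z -> `|z| = 1) /\ separable_poly P.
  by apply: root_self_inversive => //; apply: s_nz; lia.
have uniq_zs : uniq zs.
  rewrite -separable_prod_XsubC; apply: dvdp_separable sepP.
  by rewrite [X in _ %| X]defP dvdpZr.
have circle z : z \in zs -> `|z| = 1.
  by move=> z_zs; apply: circleP; rewrite defP rootZ // root_prod_XsubC.
exists zs; split=> //=; set lam := map _ _.
have circle_lam l : l \in lam -> `|l| = 1.
  by move=> /mapP[z /circle z1 ->]; rewrite normfV z1 invr1.
split=> //; first by rewrite map_inj_uniq //; exact: invr_inj.
  by move=> j lt_jn; rewrite (psum_P_poly defP lt_jn) subrr.
move=> r e e0 er r1 j; rewrite leq_eqVlt => /orP[/eqP <-|lt_nj].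
  apply: (@le_lt_trans _ _ (n.+1%:R : R)%:C%C); last first.
    by rewrite ltcR lt_bound_diag //; lia.
  (* For j = n the difference is (n+1) (c_{n+1} - conj c_n), and both coefficients are at most 1/2
     in modulus. *)
  rewrite (psum_P_poly_next defP) normrMn rmorph_nat; apply: ler_wMn2r.
  have -> : 1 = (1 / 2 : R)%:C%C + (1 / 2)%:C%C by rewrite -rmorphD -splitr rmorph1.
  by apply: le_trans (ler_normB _ _) (lerD _ _); rewrite ?normcJ s_small //; lia.
apply: (@lt_le_trans _ _ ((4 * j.+1%:R : R)%:C)%C); last first.
  by rewrite lecR le_bound_above //; lia.
have psum_le : `|psum lam j.+1| <= (2 * n + 1)%:R.
  rewrite -size_zs -(size_map (fun z => z^-1)) -/lam /psum (le_trans (ler_norm_sum _ _ _)) //.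
  rewrite big_seq (eq_bigr (fun=> 1)) -?big_seq ?big_const_seq ?count_predT ?iter_addr_0 //.
  by move=> l /circle_lam l1; rewrite normrX l1 expr1n.
apply: le_lt_trans (le_trans (ler_normB _ _) (lerD psum_le (a_le j))) _.
(* It remains that 2n + 1 + T < 4 (j + 1), which holds as T < n < j. *)
rewrite rmorphM !rmorph_nat -natrD -natrM ltr_nat; lia.
Qed.
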